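(* For Lebesgue almost every length vector $(\ell_1,\ell_2,\ell_3)$ (with $\ell_i>0$, $\ell_1+\ell_2+\ell_3=1$), the $3$-interval exchange transformation $T$ with these lengths and permutation $\pi=(3\ 2\ 1)$ (i.e. $\pi(k)=4-k$) satisfies, for every $\alpha>0$, \[\liminf_{n\to\infty} n^\alpha\,|T^n(x)-T^n(y)|=\infty\quad\text{for } \lambda\times\lambda\text{-almost every }(x,y)\in[0,1)^2,\] where $\lambda$ is Lebesgue measure on $[0,1)$.
   Context: An $r$-interval exchange transformation is given by a permutation $\pi$ of $\{1,\dots,r\}$ and lengths $\ell_i>0$ with $\sum\ell_i=1$: with $s_0=0$, $s_k=\sum_{i\le k}\ell_i$, $I_k=[s_{k-1},s_k)$, one sets $T(x)=x-\sum_{i<k}\ell_i+\sum_{\pi(i')<\pi(k)}\ell_{i'}$ for $x\in I_k$. ''Lebesgue almost every length vector'' refers to Lebesgue measure on the $2$-dimensional simplex of such vectors. *)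

(* Defs.v *)
From HB Require Import structures.
From mathcomp Require Import all_boot all_order all_algebra all_fingroup.
From mathcomp Require Import all_classical all_reals all_analysis.
Set Implicit Arguments. Unset Strict Implicit. Unset Printing Implicit Defensive.
Import Order.TTheory GRing.Theory Num.Theory.
Local Open Scope ring_scope.

Section IET.
Variable R : realType.

Definition iet_left (r : nat) (l : 'I_r -> R) (k : 'I_r) : R :=
  \sum_(i < r | (i < k)%N) l i.

(* The r-interval exchange transformation with permutation pi and lengths l:
   for x in I_k = [s_{k-1}, s_k), T x = x - sum_{i<k} l_i + sum_{pi i < pi k} l_i.
   Outside [0, sum l) (irrelevant for the statement) T is the identity. *)
Definition iet (r : nat) (pi : {perm 'I_r}) (l : 'I_r -> R) (x : R) : R :=
  match [pick k : 'I_r | (iet_left l k <= x) && (x < iet_left l k + l k)] with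
  | Some k => x - iet_left l k + \sum_(i < r | (pi i < pi k)%N) l i
  | None => x
  end.

Definition lens3 (l1 l2 : R) : 'I_3 -> R :=
  fun i => match val i with 0 => l1 | 1 => l2 | _ => 1 - l1 - l2 end.
End IET.

(* pi(k) = 4 - k in 1-based indexing, i.e. k |-> 2 - k in 0-based indexing *)
Definition pi321 : {perm 'I_3} := perm (@rev_ord_inj 3).

(* Main.v *)
Require Import Defs.
From HB Require Import structures.
From mathcomp Require Import all_boot all_order all_algebra all_fingroup.
From mathcomp Require Import all_classical all_reals all_analysis.
From mathcomp Require Import measurable_realfun ring lra zify.
Import Order.TTheory GRing.Theory Num.Theory.
Import numFieldNormedType.Exports.
Local Open Scope ring_scope.
Local Open Scope classical_set_scope.
Set Implicit Arguments. Unset Strict Implicit. Unset Printing Implicit Defensive.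

(* T is the first return map to [0, 1) of the rotation by 1 - l1 on a circle of
   length L = 1 + l2. Hence T^n x - T^n y = x - y + k (1 - l1) - p L for some
   integers k and p, where |k| is bounded by the discrepancy of the rotation.
   By Borel-Cantelli, for almost every length vector be = (1 - l1) / L
   satisfies q |q be - p| >= c / log^2 q; Denjoy-Koksma then bounds the
   discrepancy of 2 n points by a power of log n. By Borel-Cantelli again,
   |x - y + k (1 - l1) - p L| is for almost every (x, y) at least an inverse
   polynomial in |k|, hence an inverse power of log n. *)

(** * Discrepancy of circle rotations *)

Section Discrepancy.
Variable R : archiRealFieldType.
Implicit Types (be u v w c : R).

(** For 0 <= u - v <= 1 the difference of two such sums counts the i < N with u + i be in [0, u - v)
    modulo 1, so discrepancy becomes a comparison of two starting points. *)
Definition floor_sum be u (N : nat) : R :=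
  \sum_(i < N) (Num.floor (u + i%:R * be))%:~R.

Lemma floor_sumD be u m r :
  floor_sum be u (m + r) = floor_sum be u m + floor_sum be (u + m%:R * be) r.
Proof.
rewrite /floor_sum big_split_ord /=; congr (_ + _).
by apply: eq_bigr => i _; rewrite natrD mulrDl addrA.
Qed.

(** The sum in Hermite's identity, whose value is floor (q w). *)
Definition hermite_sum q w : R := \sum_(j < q) (Num.floor (w + j%:R / q%:R))%:~R.

Lemma le_hermite_sum q u v : u <= v -> hermite_sum q u <= hermite_sum q v.
Proof.
by move=> uv; apply: ler_sum => i _; rewrite ler_int le_floor// lerD2r.
Qed.

(** The shift by 1/q turns each term into the next one, and the last term becomes floor (w + 1), the
    old first term plus 1. *)
Lemma hermite_sum_step q w : (0 < q)%N ->
  hermite_sum q (w + q%:R^-1) = hermite_sum q w + 1.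
Proof.
case: q => // q _; rewrite /hermite_sum big_ord_recr big_ord_recl /=.
have q0 : (q.+1%:R : R) != 0 by rewrite pnatr_eq0.
have -> : w + q.+1%:R^-1 + q%:R / q.+1%:R = w + 1%:~R.
  by move: q0; rewrite -natr1 => q0; field.
rewrite floorDrz ?intr_int// intrKfloor mul0r addr0 intrD addrC -addrA [RHS]addrAC.
rewrite -addrA; congr (_ + (_ + _)).
apply: eq_bigr => i _; congr (_%:~R); congr Num.floor.
by rewrite /bump/= add1n -addrA -(natr1 i) mulrDl mul1r [X in _ + X]addrC.
Qed.

Lemma hermite_sum_shift q w (m : int) : (0 < q)%N ->
  hermite_sum q (w + m%:~R / q%:R) = hermite_sum q w + m%:~R.
Proof.
move=> q0; elim: m => [|m IH|m IH]; first by rewrite mul0r !addr0.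
- rewrite -addn1 PoszD intrD mulrDl addrA mul1r hermite_sum_step// IH.
  by rewrite addrA.
- have := hermite_sum_step (w + (- m.+1%:Z)%:~R / q%:R) q0.
  have E : (- m.+1%:Z)%:~R / q%:R + q%:R^-1 = (- m%:Z)%:~R / q%:R :> R.
    by rewrite -[X in _ + X]mul1r -mulrDl -[X in _ + X]/(1%:~R : R) -intrD;
      congr (_ %:~R / _); lia.
  have := hermite_sum_step (w + (- m.+1%:Z)%:~R / q%:R) q0.
  rewrite -addrA E IH => H.
  have -> : (- m.+1%:Z)%:~R = (- m%:Z)%:~R - 1 :> R.
    by rewrite -[X in _ - X]/(1%:~R : R) -intrB; congr (_%:~R); lia.
  by move: H; lra.
Qed.

(** With m = floor (q (u - v)), u lies between v + m/q and v + (m + 1)/q, where monotonicity and the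
    shift rule apply. *)
Lemma hermite_sum_bound q u v : (0 < q)%N ->
  `|hermite_sum q u - hermite_sum q v - q%:R * (u - v)| <= 1.
Proof.
move=> q0; set m := Num.floor (q%:R * (u - v)).
have q0' : 0 < q%:R :> R by rewrite ltr0n.
have := floor_itv (q%:R * (u - v)); rewrite -/m intrD => /andP[m1 m2].
have H1 : hermite_sum q v + m%:~R <= hermite_sum q u.
  rewrite -hermite_sum_shift//; apply: le_hermite_sum.
  by rewrite -lerBrDl ler_pdivrMr// mulrC.
have H2 : hermite_sum q u <= hermite_sum q v + (m + 1)%:~R.
  rewrite -hermite_sum_shift//; apply: le_hermite_sum.
  by rewrite -lerBlDl ler_pdivlMr// mulrC intrD ltW.
move: H2; rewrite intrD => H2; rewrite ler_norml; apply/andP; split; lra.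
Qed.

(** Since p is invertible modulo q, k p mod q runs through all residues; the quotients leave the
    floors as integers that do not depend on w. *)
Lemma floor_sum_rat p q w : coprime p q -> (0 < q)%N ->
  floor_sum (p%:R / q%:R) w q = (\sum_(k < q) (k * p %/ q)%N)%:R + hermite_sum q w.
Proof.
move=> pq q0; have q0' : (q%:R : R) != 0 by rewrite pnatr_eq0 -lt0n.
pose h (k : 'I_q) := Ordinal (ltn_pmod (k * p) q0).
have hI : injective h.
  move=> i j /(congr1 val) /= /eqP.
  wlog ij : i j / (i <= j)%N.
    by move=> W; case: (leqP i j) => [/W//|/ltnW /W H]; rewrite eq_sym => /H ->.
  rewrite eq_sym eqn_mod_dvd ?leq_mul2r ?ij ?orbT//.
  rewrite -mulnBl Gauss_dvdl 1?coprime_sym// => dv.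
  have ji : (j - i)%N = 0%N.
    apply/eqP; case: posnP => // ji0; move: (dvdn_leq ji0 dv).
    by rewrite leqNgt (leq_ltn_trans (leq_subr _ _)).
  by apply/val_inj/eqP; rewrite eqn_leq ij /= -subn_eq0 ji.
rewrite [X in _ + X](reindex_inj hI) natr_sum -big_split /=.
apply: eq_bigr => k _.
have -> : w + k%:R * (p%:R / q%:R) =
          w + (k * p %% q)%N%:R / q%:R + (k * p %/ q)%N%:Z%:~R :> R.
  by rewrite mulrA -natrM {1}(divn_eq (k * p) q) natrD natrM -pmulrn; field.
by rewrite floorDrz ?intr_int// intrKfloor intrD addrC.
Qed.

(** For k < q the points k be and k p/q are at most 1/q apart, so the sum at w lies between rational
    sums at w - 1/q and w + 1/q, each 1 away from the one at w. This costs 2 for u and v together,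
    and [hermite_sum_bound] costs 1 more. *)
Lemma denjoy_koksma p q be u v : coprime p q -> (0 < q)%N ->
  q%:R * `|q%:R * be - p%:R| <= 1 ->
  `|floor_sum be u q - floor_sum be v q - q%:R * (u - v)| <= 4.
Proof.
move=> pq q0 h.
have q0' : 0 < q%:R :> R by rewrite ltr0n.
have close k : (k < q)%N -> `|k%:R * be - k%:R * (p%:R / q%:R)| <= q%:R^-1.
  move=> kq; rewrite -(ler_pM2l q0') divff ?gt_eqF// (le_trans _ h)//.
  have -> : k%:R * be - k%:R * (p%:R / q%:R) = k%:R / q%:R * (q%:R * be - p%:R).
    by field; rewrite gt_eqF.
  rewrite normrM ger0_norm ?divr_ge0// mulrA ler_wpM2r//.
  by rewrite mulrC divfK ?gt_eqF// ler_nat ltnW.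
have up w : floor_sum be w q <= floor_sum (p%:R / q%:R) (w + q%:R^-1) q.
  apply: ler_sum => k _; rewrite ler_int le_floor//.
  by have := close _ (ltn_ord k); rewrite ler_norml => /andP[]; lra.
have lo w : floor_sum (p%:R / q%:R) (w - q%:R^-1) q <= floor_sum be w q.
  apply: ler_sum => k _; rewrite ler_int le_floor//.
  by have := close _ (ltn_ord k); rewrite ler_norml => /andP[]; lra.
have [] := (up u, lo u); have [] := (up v, lo v).
rewrite !floor_sum_rat// !hermite_sum_step//.
have mv w := hermite_sum_step (w - q%:R^-1) q0.
have := (mv u, mv v); rewrite !subrK => -[hu hv].
have := hermite_sum_bound u v q0; rewrite !ler_norml => /andP[] *.
by apply/andP; split; lra.
Qed.

(** Pigeonhole: the fractional parts of k be for k = 0, ..., Q fall into Q boxes of length 1/Q. *)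
Lemma dirichlet be Q : 0 <= be -> (0 < Q)%N ->
  exists p q : nat, [/\ coprime p q, (0 < q <= Q)%N & `|q%:R * be - p%:R| < Q%:R^-1].
Proof.
move=> be0 Q0; have Q0' : 0 < Q%:R :> R by rewrite ltr0n.
pose fr (k : nat) : R := k%:R * be - (Num.floor (k%:R * be))%:~R.
have fr01 k : 0 <= fr k < 1.
  by have := floor_itv (k%:R * be); rewrite intrD /fr; lra.
have frQ k : (Num.truncn (Q%:R * fr k) < Q)%N.
  have /andP[f0 f1] := fr01 k.
  by rewrite truncn_lt_nat ?mulr_ge0// -[X in _ < X]mulr1 ltr_pM2l.
pose g (k : 'I_Q.+1) := Ordinal (frQ k).
have /injectivePn [i [j ij gij]] : ~~ injectiveb g.
  by apply/injectiveP => /leq_card; rewrite !card_ord ltnn.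
wlog {ij} ij : i j gij / (i < j)%N.
  move=> W; move: ij; rewrite neq_ltn => /orP[|] ij; first exact: (W i j).
  exact: (W j i).
have hij :
    `|(j - i)%N%:R * be - (Num.floor (j%:R * be) - Num.floor (i%:R * be))%:~R| < Q%:R^-1.
  have := congr1 val gij => /= e.
  have ti := truncn_itv (mulr_ge0 (ltW Q0') (proj1 (andP (fr01 i)))).
  have tj := truncn_itv (mulr_ge0 (ltW Q0') (proj1 (andP (fr01 j)))).
  rewrite -e -natr1 in tj; rewrite -natr1 in ti.
  rewrite -(ltr_pM2l Q0') divff ?gt_eqF// -[X in X * `|_|](gtr0_norm Q0') -normrM.
  rewrite natrB 1?ltnW// intrB.
  have -> : Q%:R * ((j%:R - i%:R) * be -
      ((Num.floor (j%:R * be))%:~R - (Num.floor (i%:R * be))%:~R)) =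
      Q%:R * fr j - Q%:R * fr i by rewrite /fr; ring.
  by rewrite ltr_norml; lra.
have m0 : 0 <= Num.floor (j%:R * be) - Num.floor (i%:R * be).
  by rewrite subr_ge0 le_floor// ler_wpM2r// ler_nat ltnW.
move: hij; move: (Num.floor (j%:R * be) - Num.floor (i%:R * be)) m0 => [p|//] _.
rewrite -pmulrn; set d := (j - i)%N.
have d0 : (0 < d)%N by rewrite subn_gt0.
have dQ : (d <= Q)%N by rewrite (leq_trans (leq_subr _ _))// -ltnS.
(* Dividing p and d by their gcd gives coprimality; it divides the error by e as well, so the bound
   survives. *)
set e := gcdn p d; have e0 : (0 < e)%N by rewrite gcdn_gt0 d0 orbT.
move=> hd; exists (p %/ e)%N, (d %/ e)%N; split.
- rewrite /coprime -(eqn_pmul2r e0) mul1n muln_gcdl.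
  by rewrite !divnK ?dvdn_gcdl ?dvdn_gcdr.
- by rewrite divn_gt0// dvdn_leq ?dvdn_gcdr// (leq_trans (leq_div _ _)).
- apply: le_lt_trans hd.
  have Ed : d%:R = (d %/ e)%:R * e%:R :> R by rewrite -natrM divnK ?dvdn_gcdr.
  have Ep : p%:R = (p %/ e)%:R * e%:R :> R by rewrite -natrM divnK ?dvdn_gcdl.
  rewrite Ed Ep mulrAC -mulrBl normrM ler_peMr// ger0_norm// ler1n//.
Qed.

Lemma floor_sum_mul be q u v (m : nat) (B : R) :
  (forall u v, `|floor_sum be u q - floor_sum be v q - q%:R * (u - v)| <= B) ->
  `|floor_sum be u (m * q) - floor_sum be v (m * q) - (m * q)%:R * (u - v)|
    <= m%:R * B.
Proof.
move=> hB; elim: m u v => [|m IH] u v.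
  by rewrite mul0n /floor_sum !big_ord0 !mul0r !subrr normr0.
rewrite mulSn !floor_sumD natrD.
have := hB u v; have := IH (u + q%:R * be) (v + q%:R * be).
rewrite -[in m.+1%:R]natr1 !ler_norml => /andP[h1 h2] /andP[h3 h4].
by apply/andP; split; lra.
Qed.

Lemma floor_sum_discrepancy be c (J N : nat) u v : 0 <= be <= 1 -> 0 < c ->
  (forall p q j : nat, (2 ^ j <= q < 2 ^ j.+1)%N -> (p <= q)%N ->
     c <= (j.+1 * j.+2)%:R * (q%:R * `|q%:R * be - p%:R|)) ->
  (N < 2 ^ J)%N ->
  `|floor_sum be u N - floor_sum be v N - N%:R * (u - v)|
    <= 4 * (J * (J.+1 * J.+2))%:R / c.
Proof.
move=> /andP[be0 be1] c0 hc.
elim: J N u v => [|J IH] N u v NJ.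
  move: NJ; rewrite expn0 ltnS leqn0 => /eqP ->.
  by rewrite /floor_sum !big_ord0 mul0n !mul0r !subrr normr0 mulr0 mul0r.
have [->|N0] := posnP N.
  by rewrite /floor_sum !big_ord0 !mul0r !subrr normr0 divr_ge0 ?mulr_ge0 ?ltW.
(* Write N = m q + r with q from Dirichlet's theorem: the hypothesis on be bounds
   m, Denjoy-Koksma bounds each of the m blocks, and r < N / 2. *)
have [p [q [pq /andP[q0 qN] hpq]]] := dirichlet be0 N0.
have q0' : 0 < q%:R :> R by rewrite ltr0n.
have N0' : 0 < N%:R :> R by rewrite ltr0n.
have NV1 : N%:R^-1 <= 1 :> R by rewrite invf_le1// ler1n.
have ple : (p <= q)%N.
  rewrite -ltnS -(ltr_nat R) -natr1.
  have : q%:R * be <= q%:R by rewrite ler_piMr.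
  by move: hpq; rewrite ltr_norml => /andP[]; lra.
have qN' : q%:R * `|q%:R * be - p%:R| <= q%:R / N%:R.
  by rewrite ler_wpM2l// ltW.
have blk u' v' : `|floor_sum be u' q - floor_sum be v' q - q%:R * (u' - v')| <= 4.
  apply: denjoy_koksma pq q0 _; apply: le_trans qN' _.
  by rewrite ler_pdivrMr// mul1r ler_nat.
pose j := trunc_log 2 q.
have jq : (2 ^ j <= q < 2 ^ j.+1)%N by apply: trunc_log_bounds.
have jJ : (j <= J)%N.
  rewrite -ltnS -(@ltn_exp2l 2)//; apply: leq_ltn_trans NJ.
  by case/andP: jq => jq _; apply: leq_trans jq qN.
(* Dirichlet gives q |q be - p| <= q / N, and the hypothesis bounds the left side from below by c /
   ((j + 1)(j + 2)). *)
have mle : (N %/ q)%:R <= (J.+1 * J.+2)%:R / c.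
  have Nq : (N %/ q)%:R <= N%:R / q%:R :> R.
    by rewrite ler_pdivlMr// -natrM ler_nat leq_divM.
  apply: le_trans Nq _; rewrite ler_pdivrMr// mulrAC ler_pdivlMr//.
  have K : (j.+1 * j.+2)%:R <= (J.+1 * J.+2)%:R :> R by rewrite ler_nat leq_mul.
  rewrite mulrC (@le_trans _ _ ((j.+1 * j.+2)%:R * q%:R))//; last exact: ler_wpM2r.
  rewrite -ler_pdivlMr// -mulrA; apply: le_trans (hc p q j jq ple) _.
  exact: ler_wpM2l.
rewrite {1 2 3}(divn_eq N q) !floor_sumD natrD.
have rJ : (N %% q < 2 ^ J)%N.
  rewrite -(@ltn_pmul2l 2)// -expnS (leq_ltn_trans _ NJ)//.
  rewrite mul2n -addnn {3}(divn_eq N q) leq_add2r.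
  by rewrite (leq_trans (ltnW (ltn_pmod N q0)))// leq_pmull// divn_gt0.
set w := _ * be; have := IH (N %% q)%N (u + w) (v + w) rJ.
have := floor_sum_mul u v (N %/ q)%N blk.
have J1 : (J * (J.+1 * J.+2))%:R <= (J * (J.+2 * J.+3))%:R :> R.
  by rewrite ler_nat leq_mul2l leq_mul ?orbT.
have J2 : (J.+1 * J.+2)%:R <= (J.+2 * J.+3)%:R :> R by rewrite ler_nat leq_mul.
have cV : 0 < c^-1 by rewrite invr_gt0.
rewrite -(ler_pM2r cV) in J1; rewrite -(ler_pM2r cV) in J2.
(* The first summand pays for the m blocks, the second for the remainder by induction. *)
have -> : (J.+1 * (J.+2 * J.+3))%:R = (J.+2 * J.+3)%:R + (J * (J.+2 * J.+3))%:R :> R.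
  by rewrite -natrD.
rewrite mulrDr mulrDl -!mulrA.
move: J1 J2 mle; rewrite !ler_norml => ? ? ? /andP[? ?] /andP[? ?].
by apply/andP; split; lra.
Qed.
End Discrepancy.

(** * The exchange as a first return map of a rotation *)

Section Orbit.
Variable R : realType.
Implicit Types (a b : R).

Local Notation iet321 a b := (iet pi321 (lens3 a b)).

(* Since floor s - floor (s - 1 / L) is 1 if s mod 1 lies in [0, 1 / L) and 0
   otherwise, this counts the i < k such that x + i (1 - a) lies in [0, 1)
   modulo L = 1 + b. *)
Definition visits a b (x : R) k : R :=
  floor_sum ((1 - a) / (1 + b)) (x / (1 + b)) k -
  floor_sum ((1 - a) / (1 + b)) ((x - 1) / (1 + b)) k.

Lemma sum_ord3 (P : pred 'I_3) (F : 'I_3 -> R) :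
  \sum_(i < 3 | P i) F i = (if P ord0 then F ord0 else 0) +
    ((if P (lift ord0 ord0) then F (lift ord0 ord0) else 0) +
     (if P ord_max then F ord_max else 0)).
Proof.
rewrite big_mkcond !big_ord_recl big_ord0 /= addr0.
by have -> : lift ord0 (lift ord0 ord0) = ord_max :> 'I_3 by exact: val_inj.
Qed.

Lemma iet321E a b (x : R) : 0 < a -> 0 < b -> a + b < 1 -> 0 <= x < 1 ->
  (iet321 a b) x = if x < a then x + (1 - a)
        else if x < a + b then x + (1 - 2 * a - b) else x - (a + b).
Proof.
move=> a0 b0 ab1 /andP[x0 x1]; rewrite /iet /iet_left.
case: pickP => [k|].
  rewrite !sum_ord3 !permE /lens3 /=.
  case: k => [[|[|[|//]]] k3] /=.
  - rewrite !addr0 add0r => /andP[_ ->]; ring.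
  - rewrite !addr0 !add0r => /andP[xa xb]; rewrite xb ltNge xa /=; ring.
  - rewrite !addr0 => /andP[xa xb].
    by rewrite !ltNge xa (le_trans _ xa) ?lerDl ?ltW//= ; ring.
move=> /= H.
have := (H ord0, H (inord 1), H (inord 2)).
rewrite !sum_ord3 /lens3 /= !inordK//=.
rewrite !addr0 !add0r x0 /=; case: (ltP x a) => /= xa [[] //].
case: (ltP x (a + b)) => //= xb _.
by have -> : x < a + b + (1 - a - b) by lra.
Qed.

(** The outer intervals return after one rotation step. The middle one needs two, since t + (1 - a)
    falls into the gap [1, 1 + b); hence k <= 2 n. The last equation says that k is a time with n
    visits before it. *)
Lemma orbit_rotation a b (x : R) n : 0 < a -> 0 < b -> a + b < 1 ->
  0 <= x < 1 ->
  exists (k : nat) (p : int),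
    [/\ iter n (iet321 a b) x = x + k%:R * (1 - a) - p%:~R * (1 + b),
        0 <= iter n (iet321 a b) x < 1,
        (k <= 2 * n)%N &
        n%:R = visits a b x k].
Proof.
rewrite /visits => a0 b0 ab1 x01; elim: n => [|n [k [p [E /andP[t0 t1] kn S]]]].
  exists 0%N, 0; rewrite /floor_sum !big_ord0 /=; split => //; last by rewrite subr0.
  by rewrite !mul0r addr0 subr0.
have L0 : 0 < (1 + b) by rewrite addr_gt0.
set t := iter n (iet321 a b) x in E t0 t1.
have fl (s : R) (m : int) :
    m%:~R * (1 + b) <= s < m%:~R * (1 + b) + (1 + b) ->
    Num.floor (s / (1 + b)) = m.
  move=> /andP[s1 s2]; apply/eqP; rewrite floor_eq ler_pdivlMr// s1 ltr_pdivrMr//.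
  by rewrite intrD mulrDl mul1r.
have fE (s : R) (j : nat) :
    s / (1 + b) + j%:R * ((1 - a) / (1 + b)) = (s + j%:R * (1 - a)) / (1 + b).
  by rewrite (mulrDl s) mulrA.
have step s m : floor_sum ((1 - a) / (1 + b)) (s / (1 + b)) m.+1 =
    floor_sum ((1 - a) / (1 + b)) (s / (1 + b)) m +
    (Num.floor ((s + m%:R * (1 - a)) / (1 + b)))%:~R.
  by rewrite /floor_sum big_ord_recr /= fE.
(* Time k is a visit: the orbit point is t + p L with t in [0, 1), so the two floors are p and p -
   1. *)
have visit : floor_sum ((1 - a) / (1 + b)) (x / (1 + b)) k.+1 -
    floor_sum ((1 - a) / (1 + b)) ((x - 1) / (1 + b)) k.+1
    = n.+1%:R.
  rewrite !step (fl _ p) ?(fl _ (p - 1)) -?natr1 ?S ?intrB; first by ring.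
    by apply/andP; split; lra.
  by apply/andP; split; lra.
rewrite iterS -/t iet321E ?t0//.
case: ltP => [ta|ta].
  exists k.+1, p; split.
  - by rewrite E -natr1; ring.
  - by apply/andP; split; lra.
  - lia.
  - by rewrite visit.
case: ltP => [tb|tb].
  (* At the intermediate time k + 1 the point is in the gap, both floors equal p, and no visit is
     counted. *)
  exists k.+2, (p + 1); split.
  - by rewrite E -!natr1 intrD; ring.
  - by apply/andP; split; lra.
  - lia.
  - rewrite -visit !(step _ k.+1) (fl _ p) ?(fl _ p) ?intrB; first by ring.
      by rewrite -natr1 in E *; apply/andP; split; lra.
    by rewrite -natr1 in E *; apply/andP; split; lra.
exists k.+1, (p + 1); split.
- by rewrite E -natr1 intrD; ring.
- by apply/andP; split; lra.
- lia.
- by rewrite visit.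
Qed.

(** Both orbits have made n visits, and k rotation steps make k / (1 + b) visits up to D, so the two
    times differ by at most 2 (1 + b) D. The bound on p follows because x - y and the difference of
    the iterates are both at most 1 in absolute value. *)
Lemma orbit_difference a b (x y D : R) n : 0 < a -> 0 < b -> a + b < 1 ->
  0 <= x < 1 -> 0 <= y < 1 ->
  (forall (k : nat) u v, (k <= 2 * n)%N ->
    `|floor_sum ((1 - a) / (1 + b)) u k - floor_sum ((1 - a) / (1 + b)) v k -
      k%:R * (u - v)| <= D) ->
  exists k p : int,
    [/\ iter n (iet321 a b) x - iter n (iet321 a b) y =
        x - y + k%:~R * (1 - a) - p%:~R * (1 + b),
        `|k%:~R| <= 2 * (1 + b) * D & `|p%:~R| <= `|k%:~R| + 2 :> R].
Proof.
move=> a0 b0 ab1 x01 y01 hD; have L0 : 0 < (1 + b) by rewrite addr_gt0.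
have [kx [px [Ex Tx kxn Sx]]] := orbit_rotation n a0 b0 ab1 x01.
have [ky [py [Ey Ty kyn Sy]]] := orbit_rotation n a0 b0 ab1 y01.
have E : iter n (iet321 a b) x - iter n (iet321 a b) y =
    x - y + (kx%:Z - ky%:Z)%:~R * (1 - a) - (px - py)%:~R * (1 + b).
  by rewrite Ex Ey !intrB -!pmulrn; ring.
exists (kx%:Z - ky%:Z), (px - py); split => //.
  have := hD _ (x / (1 + b)) ((x - 1) / (1 + b)) kxn.
  have := hD _ (y / (1 + b)) ((y - 1) / (1 + b)) kyn.
  have d (z : R) : z / (1 + b) - (z - 1) / (1 + b) = (1 + b)^-1.
    by rewrite -mulrBl subKr mul1r.
  rewrite /visits in Sx Sy; rewrite -Sx -Sy !d => h1 h2.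
  have : `|(kx%:R - ky%:R) / (1 + b)| <= 2 * D.
    by move: h1 h2; rewrite !ler_norml mulrBl => /andP[? ?] /andP[? ?];
      apply/andP; split; lra.
  rewrite normrM (gtr0_norm (_ : 0 < (1 + b)^-1)) ?invr_gt0// ler_pdivrMr//.
  by rewrite intrB -!pmulrn mulrAC.
move: E; set k := kx%:Z - ky%:Z; set p := px - py.
have : `|k%:~R * (1 - a)| <= `|k%:~R : R|.
  by rewrite normrM ler_piMr// ler_norml; apply/andP; split; lra.
have pL : `|p%:~R| <= `|p%:~R * (1 + b)|.
  by rewrite normrM ler_peMr// gtr0_norm// lerDl ltW.
move=> kk E; apply: le_trans pL _.
have -> : p%:~R * (1 + b) = x - y + k%:~R * (1 - a) -
    (iter n (iet321 a b) x - iter n (iet321 a b) y) by rewrite E; ring.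
move: kk Tx Ty x01 y01; rewrite !ler_norml.
move=> /andP[? ?] /andP[? ?] /andP[? ?] /andP[? ?] /andP[? ?].
by apply/andP; split; lra.
Qed.
End Orbit.

(** * A quantitative Borel-Cantelli lemma on the plane *)

Section AvoidBalls.
Variable R : realType.
Notation lam := (@lebesgue_measure R).

Lemma measure_bigsetU_le d (T : measurableType d) (mu : {measure set T -> \bar R})
    (I : Type) (s : seq I) (A : I -> set T) :
  (forall i, measurable (A i)) ->
  (mu (\big[setU/set0]_(i <- s) A i) <= \sum_(i <- s) mu (A i))%E.
Proof.
move=> mA; elim: s => [|i s IH]; first by rewrite !big_nil measure0.
rewrite !big_cons; apply: le_trans (leeD2l _ IH).
by apply: measureU2 => //; exact: bigsetU_measurable.
Qed.

Lemma sum_telescope_le1 m :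
  \sum_(0 <= n < m) ((n.+1 * n.+2)%:R)^-1 <= 1 :> R.
Proof.
have -> : \sum_(0 <= n < m) ((n.+1 * n.+2)%:R)^-1 = 1 - m.+1%:R^-1 :> R.
  elim: m => [|m IH]; first by rewrite big_geq// invr1 subrr.
  rewrite big_nat_recr//= IH natrM.
  have m0 : 0 <= m%:R :> R by [].
  by rewrite -(natr1 m.+1) -(natr1 m); field; apply/andP; split; rewrite gt_eqF//; lra.
by rewrite gerBl invr_ge0.
Qed.

(** By uniqueness of the product measure, integrating over y-sections gives the same measure as
    integrating over x-sections. *)
Lemma negligible_prod_ysection (A : set (R * R)) : measurable A ->
  (forall y, lam (ysection A y) = 0) -> (lam \x lam)%E.-negligible A.
Proof.
move=> mA A0; apply/negligibleP => //.
transitivity ((lam \x^ lam)%E A); last first.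
  by rewrite /product_measure2 integral0_eq// => y _ /=; rewrite A0.
apply: product_measure_unique => // A1 A2 mA1 mA2; exact: product_measure2E.
Qed.

(** For fixed z.2 the points [f n i z.2] are centres of intervals to be avoided by z.1. The factor 1
    / ((n + 1)(n + 2)) makes the total length summable, and scaling all radii by 1 / (k + 1) makes
    it arbitrarily small. *)
Lemma ae_avoid_balls (I : nat -> finType) (f : forall n, I n -> R -> R) :
  (forall n i, measurable_fun setT (@f n i)) ->
  {ae (lam \x lam)%E, forall z : R * R, exists2 c : R, 0 < c &
    forall n (i : I n), c <= (#|I n| * (n.+1 * n.+2))%:R * `|z.1 - f n i z.2|}.
Proof.
move=> mf.
pose rho k n : R := (k.+1 * #|I n| * (n.+1 * n.+2))%:R^-1.
pose E k n (i : I n) := [set z : R * R | `|z.1 - f n i z.2| < rho k n].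
pose F k n := \big[setU/set0]_(i <- enum (I n)) E k n i.
pose U k := \bigcup_n F k n.
have mE k n i : measurable (E k n i).
  have mg : measurable_fun setT (fun z : R * R => `|z.1 - f n i z.2|).
    apply: measurableT_comp => //; apply: measurable_funB => //.
    exact: measurableT_comp (mf n i) measurable_snd.
  have -> : E k n i =
      setT `&` (fun z : R * R => `|z.1 - f n i z.2|) @^-1` `]-oo, rho k n[.
    by rewrite setTI; apply/seteqP; split => z /=; rewrite /E in_itv.
  by apply: mg.
have mF k n : measurable (F k n) by exact: bigsetU_measurable.
have mU k : measurable (U k) by exact: bigcupT_measurable.
have yE k n i y : ysection (E k n i) y = ball (f n i y) (rho k n).
  by apply/seteqP; split => x /=; rewrite /ysection /= inE /E /ball /= distrC.
have yU k y : (lam (ysection (U k) y) <= (2 / k.+1%:R)%:E)%E.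
  rewrite ysection_bigcup.
  have mFy n : measurable (ysection (F k n) y) by exact: measurable_ysection.
  apply: le_trans (generalized_Boole_inequality lam mFy (bigcupT_measurable _ mFy)) _.
  apply: lime_le => //; first exact: is_cvg_nneseries.
  apply: nearW => m.
  have H n : (lam (ysection (F k n) y) <= (2 / k.+1%:R * ((n.+1 * n.+2)%:R)^-1)%:E)%E.
    have -> : ysection (F k n) y =
        \big[setU/set0]_(i <- enum (I n)) ysection (E k n i) y.
      rewrite /F; elim: (enum (I n)) => [|i s IH]; first by rewrite !big_nil ysection0.
      by rewrite !big_cons -IH !ysectionE.
    have mEy i : measurable (ysection (E k n i) y) by exact: measurable_ysection.
    apply: le_trans (measure_bigsetU_le lam _ mEy) _.
    rewrite (eq_bigr (fun=> (rho k n *+ 2)%:E)); last first.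
      move=> i _; rewrite yE; apply: lebesgue_measure_ball.
      by rewrite /rho invr_ge0.
    rewrite sumEFin lee_fin big_const_seq count_predT -cardE iter_addr_0.
    (* An empty [I n] contributes nothing; otherwise the number of balls cancels the cardinality in
       [rho]. *)
    have [->|c0] := posnP #|I n|; first by rewrite mulr0n mulr_ge0.
    rewrite -[X in X <= _]mulr_natr -[X in X * _]mulr_natr /rho !natrM.
    rewrite le_eqVlt; apply/orP; left.
    have c0' : #|I n|%:R != 0 :> R by rewrite pnatr_eq0 -lt0n.
    have id (x t z w : R) : x != 0 -> t != 0 -> z != 0 -> w != 0 ->
        (x * t * (z * w))^-1 * 2 * t = 2 / x * (z * w)^-1.
      by move=> x0 y0 z0 w0; field; rewrite x0 y0 z0 w0.
    by apply/eqP; rewrite id ?c0' ?pnatr_eq0.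
  apply: le_trans (lee_sum _ (fun n _ => H n)) _.
  by rewrite sumEFin lee_fin -big_distrr /= ler_piMr// sum_telescope_le1.
have N : (lam \x lam)%E.-negligible (\bigcap_k U k).
  have mB : measurable (\bigcap_k U k) by exact: bigcapT_measurable.
  apply: negligible_prod_ysection => // y.
  apply/eqP; rewrite eq_le measure_ge0 andbT; apply/lee_addgt0Pr => e e0.
  rewrite add0e.
  pose k := Num.truncn (2 / e).
  have : (lam (ysection (\bigcap_k U k) y) <= lam (ysection (U k) y))%E.
    apply: le_measure; [| |by move=> x; rewrite !ysectionE => /(_ k Logic.I)].
      by rewrite inE; exact: (measurable_ysection y mB).
    by rewrite inE; exact: (measurable_ysection y (mU k)).
  move=> /le_trans; apply; apply: le_trans (yU _ _) _; rewrite lee_fin.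
  by rewrite ler_pdivrMr// mulrC -ler_pdivrMr// ltW// truncnS_gt.
(* A point outside [U k] satisfies the estimate with constant 1 / (k + 1). *)
apply: negligibleS N => z /= Hz k _; apply: contrapT => Uk; apply: Hz.
exists k.+1%:R^-1 => [|n i]; first by rewrite invr_gt0.
rewrite leNgt; apply/negP => lt; apply: Uk; exists n => //.
rewrite /F -bigcup_seq; exists i => /=; first by rewrite mem_enum.
have c0 : (0 < #|I n|)%N by apply/card_gt0P; exists i.
rewrite /E /= /rho -mulnA natrM invfM ltr_pdivlMr ?ltr0n ?muln_gt0 ?c0//.
by rewrite mulrC.
Qed.
End AvoidBalls.

(** * Diophantine conditions that hold almost everywhere *)

Lemma ae_diophantine (R : realType) :
  {ae ((@lebesgue_measure R) \x (@lebesgue_measure R))%E, forall l : R * R,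
    0 < l.1 -> 0 < l.2 -> l.1 + l.2 < 1 ->
    exists2 c : R, 0 < c & forall p q j : nat,
      (2 ^ j <= q < 2 ^ j.+1)%N -> (p <= q)%N ->
      c <= (j.+1 * j.+2)%:R * (q%:R * `|q%:R * ((1 - l.1) / (1 + l.2)) - p%:R|)}.
Proof.
pose Idx j : finType := ('I_(2 ^ j.+1) * 'I_(2 ^ j.+1))%type.
(* With i = (q, p) this is the value of l.1 at which the rotation number (1 - l.1) / (1 + y) equals
   p / q. *)
pose f j (i : Idx j) (y : R) : R := 1 - (i.2%:R / i.1%:R) * (1 + y).
have mf j i : measurable_fun setT (@f j i).
  by apply: measurable_funB => //; apply: measurable_funM => //; exact: measurable_funD.
apply: negligibleS (ae_avoid_balls mf) => -[a b] /=.
apply: contra_not => -[c c0 H] a0 b0 ab1.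
(* The index set has 4^(j + 1) <= 4 q^2 elements, and the distance to the centre is (1 + b) / q
   times |q be - p|; the resulting factor 4 (1 + b) is below 8. *)
exists (c / 8) => [|p q j jq pq]; first by rewrite divr_gt0.
have /andP[jq1 jq2] := jq.
have q0 : 0 < q%:R :> R by rewrite ltr0n (leq_trans _ jq1)// expn_gt0.
have := H j (Ordinal jq2, Ordinal (leq_ltn_trans pq jq2)).
have L0 : 0 < 1 + b by lra.
have E : a - f j (Ordinal jq2, Ordinal (leq_ltn_trans pq jq2)) b =
    - ((1 + b) / q%:R) * (q%:R * ((1 - a) / (1 + b)) - p%:R).
  by rewrite /f /=; field; rewrite !gt_eqF.
rewrite {}E /= card_prod !card_ord normrM normrN (gtr0_norm (divr_gt0 L0 q0)).
set u := `|_|; have u0 : 0 <= u by exact: normr_ge0.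
rewrite natrM => Hc.
have cq : (2 ^ j.+1 * 2 ^ j.+1)%:R <= 4 * q%:R * q%:R :> R.
  by rewrite -!natrM ler_nat expnS; move: jq1; set w := (2 ^ j)%N; nia.
rewrite ler_pdivrMr//; apply: le_trans Hc _.
apply: (@le_trans _ _ (4 * q%:R * q%:R * (j.+1 * j.+2)%:R * ((1 + b) / q%:R * u))).
  rewrite ler_wpM2r//; last by rewrite ler_wpM2r.
  by rewrite mulr_ge0// divr_ge0// ltW.
have -> : 4 * q%:R * q%:R * (j.+1 * j.+2)%:R * ((1 + b) / q%:R * u) =
    (j.+1 * j.+2)%:R * (q%:R * u) * (4 * (1 + b)) by field; rewrite gt_eqF.
by rewrite ler_wpM2l ?mulr_ge0//; lra.
Qed.

Lemma ae_rotation_distance (R : realType) (th L : R) :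
  {ae ((@lebesgue_measure R) \x (@lebesgue_measure R))%E, forall z : R * R,
    exists2 c : R, 0 < c & forall (M : nat) (k p : int),
      (`|k| <= M)%N -> (`|p| <= M.+2)%N ->
      c <= (2 * M + 5)%:R ^+ 4 * `|z.1 - z.2 + k%:~R * th - p%:~R * L|}.
Proof.
(* The ordinals encode k + M and p + M + 2, of which the latter ranges up to 2 M + 4. *)
pose Idx M : finType := ('I_(2 * M + 5) * 'I_(2 * M + 5))%type.
pose f M (i : Idx M) (y : R) : R :=
  y - ((i.1%:R - M%:R) * th - (i.2%:R - M.+2%:R) * L).
have mf M i : measurable_fun setT (@f M i) by exact: measurable_funB.
apply: negligibleS (ae_avoid_balls mf) => -[x y] /=; apply: contra_not => -[c c0 H].
exists c => // M k p kM pM.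
have k1 : (`|(k + M%:Z)%R| < 2 * M + 5)%N by lia.
have p1 : (`|(p + M.+2%:Z)%R| < 2 * M + 5)%N by lia.
have shift (i : int) (m : nat) :
    (`|i| <= m)%N -> `|(i + m%:Z)%R|%N%:R - m%:R = i%:~R :> R.
  by move=> im; rewrite natr_absz ger0_norm ?intrD -?pmulrn ?addrK//; lia.
have := H M (Ordinal k1, Ordinal p1).
rewrite /f /= !shift// card_prod !card_ord.
have -> : x - (y - (k%:~R * th - p%:~R * L)) = x - y + k%:~R * th - p%:~R * L by ring.
(* The fourth power absorbs the (2 M + 5)^2 pairs and the weight (M + 1)(M + 2). *)
move=> /le_trans; apply; rewrite ler_wpM2r// -natrX ler_nat; nia.
Qed.

(** * Powers against logarithms, and the conclusion *)

Lemma powR_dominates_log (R : realType) (alpha A : R) (d : nat) :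
  0 < alpha -> 0 <= A ->
  exists N : nat, forall n, (N <= n)%N ->
    A * (trunc_log 2 n + 4)%:R ^+ d <= n%:R `^ alpha.
Proof.
move=> al0 A0; pose s := alpha * ln 2.
have s0 : 0 < s by rewrite mulr_gt0// ln_gt0// ltr1n.
(* With t = [trunc_log 2 n], n^alpha is at least exp (s t), hence at least the series term (s t)^(d
   + 1) / (d + 1)!. This exceeds A (5 t)^d once t >= B, and t + 4 <= 5 t for t >= 1. *)
pose B := A * 5 ^+ d * (d.+1)`!%:R / s ^+ d.+1.
have B0 : 0 <= B by rewrite divr_ge0 ?mulr_ge0 ?exprn_ge0// ltW.
pose m := (Num.truncn B).+1.
exists (2 ^ m)%N => n mn.
have n0 : (0 < n)%N by rewrite (leq_trans _ mn)// expn_gt0.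
pose t := trunc_log 2 n.
have mt : (m <= t)%N by rewrite -(@trunc_expnK 2 m)// leq_trunc_log.
have t0 : (0 < t)%N by rewrite (leq_trans _ mt).
have Bt : B <= t%:R by rewrite (@le_trans _ _ m%:R)// ?ler_nat// ltW// truncnS_gt.
have tn : (2 ^ t <= n)%N by exact: trunc_logP.
have -> : n%:R `^ alpha = expR (alpha * ln n%:R) :> R.
  by rewrite /powR pnatr_eq0 eqn0Ngt n0.
have E1 : s * t%:R <= alpha * ln n%:R.
  rewrite -mulrA ler_pM2l// mulr_natr -lnXn// ler_ln ?posrE ?exprn_gt0 ?ltr0n//.
  by rewrite -natrX ler_nat.
have st0 : 0 <= s * t%:R by rewrite mulr_ge0// ltW.
apply: le_trans (_ : expR (s * t%:R) <= _); last by rewrite ler_expR.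
apply: le_trans (expR_ge1Dxn d st0).
apply: le_trans (_ : (s * t%:R) ^+ d.+1 / (d.+1)`!%:R <= _); last by rewrite lerDr.
apply: (@le_trans _ _ (A * (5 * t%:R) ^+ d)).
  rewrite ler_wpM2l// lerXn2r ?nnegrE// ?mulr_ge0//.
  by rewrite -natrM ler_nat; lia.
clearbody s; have fa : 0 < (d.+1)`!%:R :> R by rewrite ltr0n fact_gt0.
rewrite ler_pdivlMr// !exprMn [t%:R ^+ d.+1]exprS.
have td : 0 < t%:R ^+ d :> R by rewrite exprn_gt0// ltr0n.
rewrite /B ler_pdivrMr ?exprn_gt0// in Bt.
rewrite [X in _ <= X]mulrA (_ : A * _ * _ = A * 5 ^+ d * (d.+1)`!%:R * t%:R ^+ d).
  by rewrite ler_pM2r// [X in _ <= X]mulrC.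
by ring.
Qed.

Theorem theorem4p16 (R : realType) :
  {ae ((@lebesgue_measure R) \x (@lebesgue_measure R))%E, forall l : R * R,
    0 < l.1 -> 0 < l.2 -> l.1 + l.2 < 1 ->
    forall alpha : R, 0 < alpha ->
    {ae ((@lebesgue_measure R) \x (@lebesgue_measure R))%E, forall z : R * R,
      z.1 \in `[0, 1[ -> z.2 \in `[0, 1[ ->
      limn_einf (fun n : nat =>
        ((n%:R `^ alpha) *
         `|iter n (iet pi321 (lens3 l.1 l.2)) z.1
           - iter n (iet pi321 (lens3 l.1 l.2)) z.2|)%:E) = +oo%E}}.
Proof.
have cube_le t : (t.+2 * (t.+3 * t.+4) <= (t + 4) ^ 3)%N.
  by rewrite !expnS expn0 muln1 !leq_mul//; lia.
have lin_le m : (0 < m -> 2 * m + 5 <= 7 * m)%N by lia.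
apply: negligibleS (ae_diophantine R) => -[a b] /=.
apply: contra_not => H a0 b0 ab1 al al0; have [c c0 {}H] := H a0 b0 ab1.
apply: negligibleS (ae_rotation_distance (1 - a) (1 + b)) => -[x y] /=.
apply: contra_not => -[e e0 He].
rewrite !inE /= !in_itv /= => x01 y01.
apply: (cvg_limn_einf_sup _).1; apply/cvgeyPge => A.
set T := iet pi321 (lens3 a b).
have [C C0 HC] : exists2 C : nat, (0 < C)%N & 16 <= C%:R * c.
  exists (Num.truncn (16 / c)).+1 => //.
  by rewrite -ler_pdivrMr// ltW// truncnS_gt.
have dist n : (0 < n)%N ->
    e <= (7 * C)%:R ^+ 4 * (trunc_log 2 n + 4)%:R ^+ 12 * `|iter n T x - iter n T y|.
  move=> n0; set t := trunc_log 2 n.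
  (* The discrepancy bound at J = t + 2, which is admissible because k <= 2 n < 2^(t + 2). *)
  pose D : R := 4 * (t.+2 * (t.+3 * t.+4))%:R / c.
  have hD k u v : (k <= 2 * n)%N ->
      `|floor_sum ((1 - a) / (1 + b)) u k - floor_sum ((1 - a) / (1 + b)) v k
        - k%:R * (u - v)| <= D.
    move=> kn; apply: floor_sum_discrepancy => //.
      by rewrite ler_pdivlMr ?mul0r ?ler_pdivrMr; lra.
    rewrite (leq_ltn_trans kn)// expnS ltn_pmul2l//.
    by have /andP[] := @trunc_log_bounds 2 n isT n0.
  have [k [p [-> kD pk]]] := orbit_difference a0 b0 ab1 x01 y01 hD.
  (* Since 1 + b < 2, |k| is at most 4 D, and C >= 16 / c brings this below M. Then 2 M + 5 <= 7 M
     gives the power 12 of t + 4. *)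
  pose M := (C * (t + 4) ^ 3)%N.
  have kMr : `|k%:~R : R| <= M%:R.
    apply: le_trans kD _; apply: (@le_trans _ _ (4 * D)).
      by rewrite ler_wpM2r ?divr_ge0 ?mulr_ge0 ?ltW//; lra.
    have -> : 4 * D = 16 / c * (t.+2 * (t.+3 * t.+4))%:R.
      by rewrite /D; field; rewrite gt_eqF.
    rewrite /M [X in _ <= X]natrM; apply: ler_pM => //.
    - by rewrite divr_ge0// ltW.
    - by rewrite ler_pdivrMr.
    - by rewrite ler_nat; exact: cube_le.
  have kM : (`|k| <= M)%N by rewrite -(ler_nat R) natr_absz intr_norm.
  have pM : (`|p| <= M.+2)%N.
    rewrite -(ler_nat R) natr_absz intr_norm (le_trans pk)//.
    by rewrite -(addn2 M) natrD lerD.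
  apply: le_trans (He M k p kM pM) _; rewrite ler_wpM2r//.
  rewrite -!natrX -natrM ler_nat (expnM _ 3 4) -expnMn leq_exp2r//.
  have : (0 < M)%N by rewrite muln_gt0 C0 expn_gt0 addn_gt0 orbT.
  by rewrite -mulnA -/M; exact: lin_le.
(* Once n^alpha exceeds this constant times (t + 4)^12, [dist] makes the product at least |A|. *)
have K0 : 0 <= `|A| * (7 * C)%:R ^+ 4 / e.
  by rewrite divr_ge0 ?mulr_ge0 ?exprn_ge0// ltW.
have [N HN] := powR_dominates_log 12 al0 K0.
near=> n; rewrite lee_fin.
have n0 : (0 < n)%N by near: n; exact: nbhs_infty_gt.
have /HN Pn : (N <= n)%N by near: n; exact: nbhs_infty_ge.
apply: le_trans (ler_norm A) _; apply: le_trans (ler_wpM2r (normr_ge0 _) Pn).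
apply: (@le_trans _ _ (`|A| / e * e)); first by rewrite divfK ?gt_eqF.
apply: le_trans (ler_wpM2l _ (dist n n0)) _; first by rewrite divr_ge0// ltW.
by rewrite le_eqVlt; apply/orP; left; apply/eqP; ring.
Unshelve. all: by end_near. Qed.
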